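(* Let $c>-3$ with $c\neq 1$, let $q\in\mathbb{R}$, and let $\mathscr{M}^3(c)=(\mathrm{SU}(2),g)$ be the Berger $3$-sphere of constant holomorphic sectional curvature $c$. The contact magnetic trajectory of charge $q$ in $\mathscr{M}^3(c)$ starting at the origin $\mathbf{1}$ with initial velocity $\widehat{X}\in\mathfrak{p}(c)$ is given explicitly by $$\gamma(t)=\exp_{G\times K}(t\widehat{X})\,\exp_{K}\Bigl\{t\Bigl(\frac{q}{2}\xi\Bigr)\Bigr\}.$$
   Context: Setting. $G=\mathrm{SU}(2)$ with identity $\mathbf{1}$ and Lie algebra $\mathfrak{g}=\mathfrak{su}(2)$, with basis $$\mathbf{i}=\begin{pmatrix}0&\sqrt{-1}\\ \sqrt{-1}&0\end{pmatrix},\quad \mathbf{j}=\begin{pmatrix}0&-1\\1&0\end{pmatrix},\quad \mathbf{k}=\begin{pmatrix}\sqrt{-1}&0\\0&-\sqrt{-1}\end{pmatrix}.$$ Let $E_1,E_2,E_3$ be the left invariant vector fields on $G$ with values $\mathbf{i},\mathbf{j},\mathbf{k}$ at $\mathbf{1}$; then $[E_1,E_2]=2E_3$, $[E_2,E_3]=2E_1$, $[E_3,E_1]=2E_2$. Let $g_1$ be the bi-invariant metric induced by $\langle X,Y\rangle_1=-\frac12\mathrm{tr}(XY)$, and let $\eta_1=g_1(E_3,\cdot)$. Berger sphere. For $c>-3$, $\mathscr{M}^3(c)=(G,g)$ with the left invariant metric $$g(X,Y)=\frac{4}{c+3}\Bigl(g_1(X,Y)-\frac{c-1}{c+3}\eta_1(X)\eta_1(Y)\Bigr).$$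 It carries the left invariant contact form $\eta=\frac{4}{c+3}\eta_1$ with Reeb vector field $\xi=\frac{c+3}{4}E_3$. A left invariant $g$-orthonormal frame is $e_1=\frac{\sqrt{c+3}}{2}E_1$, $e_2=\frac{\sqrt{c+3}}{2}E_2$, $e_3=\xi$. Left invariant vector fields are identified with elements of $\mathfrak{g}=T_{\mathbf{1}}G$. The holomorphic sectional curvature is the sectional curvature of planes orthogonal to $\xi$; it is constantly equal to $c$. Magnetic trajectories. The contact magnetic field is $F=\mathrm{d}\eta$ (with the convention $2\,\mathrm{d}\eta(X,Y)=X\eta(Y)-Y\eta(X)-\eta([X,Y])$). Its Lorentz force $\varphi$, defined by $F(X,Y)=g(\varphi X,Y)$, is the left invariant endomorphism field with $\varphi e_1=-e_2$, $\varphi e_2=e_1$, $\varphi e_3=0$. A contact magnetic trajectory of charge $q$ is a curve $\gamma$ with $\nabla_{\dot\gamma}\dot\gamma=q\,\varphi\dot\gamma$, where $\nabla$ is the Levi-Civita connection of $g$. Homogeneous structure. $\mathfrak{k}=\mathbb{R}\mathbf{k}$, $\mathfrak{m}=\mathbb{R}\mathbf{i}\oplus\mathbb{R}\mathbf{j}$, and $K=\{\exp(s\mathbf{k})\mid s\in\mathbb{R}\}\subset G$. The group $G\times K$ acts isometrically and transitively on $\mathscr{M}^3(c)$ by $(a,k)\cdot x=axk^{-1}$, with isotropy group at $\mathbf{1}$ equal to $\Delta K=\{(k,k)\mid k\in K\}$. The tangent space $T_{\mathbf{1}}\mathscr{M}^3(c)=\mathfrak{g}$ is identified with $$\mathfrak{p}(c)=\Bigl\{\bigl(V+W,\tfrac{1-c}{4}W\bigr)\;\Big|\;V\in\mathfrak{m},\,W\in\mathfrak{k}\Bigr\}\subset\mathfrak{g}\oplus\mathfrak{k}$$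 by letting $X=X_{\mathfrak k}+X_{\mathfrak m}\in\mathfrak{k}\oplus\mathfrak{m}=\mathfrak{g}$ correspond to $\widehat{X}=\bigl(X_{\mathfrak m}+\frac{4}{c+3}X_{\mathfrak k},\,-\frac{c-1}{c+3}X_{\mathfrak k}\bigr)$. Notation in the formula. $\exp_G,\exp_K,\exp_{G\times K}$ are the exponential maps of the respective Lie groups, and products of curves are taken in $G$. In the claim, $\exp_{G\times K}(t\widehat{X})$ stands for the curve in $\mathscr{M}^3(c)=G$ that is the orbit of $\mathbf{1}$ under this one-parameter subgroup, namely $$\exp_{G\times K}(t\widehat{X})=\exp_{G}\Bigl\{t\Bigl(X_{\mathfrak m}+\frac{4}{c+3}X_{\mathfrak k}\Bigr)\Bigr\}\,\exp_{K}\Bigl\{t\Bigl(\frac{c-1}{c+3}X_{\mathfrak k}\Bigr)\Bigr\},$$ where $X=X_{\mathfrak k}+X_{\mathfrak m}\in\mathfrak{g}$ corresponds to $\widehat{X}$.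
   Formalization: The displayed curve has initial velocity X + (q/2)ξ, not X, so the claim fails for q ≠ 0; the formal theorem takes X̂ as the initial velocity of the orbit exp_{G×K}(tX̂) and gives the trajectory the initial velocity X + (q/2)ξ. *)

(* Defs.v *)
From HB Require Import structures.
From mathcomp Require Import all_boot all_order all_algebra.
From mathcomp Require Import sesquilinear spectral.
From mathcomp Require Import complex.
From mathcomp Require Import all_classical all_reals all_analysis.

Set Implicit Arguments.
Unset Strict Implicit.
Unset Printing Implicit Defensive.

Import Order.TTheory GRing.Theory Num.Theory.
Import numFieldNormedType.Exports.

Local Open Scope ring_scope.
Local Open Scope complex_scope.
Local Open Scope sesquilinear_scope.

Notation mat2 R := 'M[R[i]]_2.

Section Algebra.
Variable R : realType.
Implicit Types (a X Y Z : mat2 R) (r c q t : R).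

Definition mx22 (x y z w : R[i]) : mat2 R :=
  \matrix_(i, j) if i == 0 then (if j == 0 then x else y)
                 else (if j == 0 then z else w).

Definition SU2 a : Prop := a \is unitarymx /\ \det a = 1.

Definition su2 X : Prop := X ^t* = - X /\ \tr X = 0.

Definition ii : mat2 R := mx22 0 'i 'i 0.
Definition jj : mat2 R := mx22 0 (-1) 1 0.
Definition kk : mat2 R := mx22 'i 0 0 (- 'i).

(* [mat2 R] is only an R[i]-module; su(2) is a real Lie algebra. *)
Definition rscale r X : mat2 R := r%:C *: X.

Definition bracket X Y : mat2 R := X * Y - Y * X.

(* The trace is real on su(2), so taking the real part loses nothing there. *)
Definition g1 X Y : R := - (1 / 2) * complex.Re (\tr (X * Y)).

Definition eta1 X : R := g1 kk X.

Definition berger c X Y : R :=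
  4 / (c + 3) * (g1 X Y - (c - 1) / (c + 3) * (eta1 X * eta1 Y)).

Definition contact_form c X : R := 4 / (c + 3) * eta1 X.

Definition xi c : mat2 R := rscale ((c + 3) / 4) kk.

(* d eta on left invariant fields: 2 d eta (X, Y) = - eta [X, Y], because the
   functions eta(X) and eta(Y) are constant. *)
Definition magnetic_field c X Y : R := - (1 / 2) * contact_form c (bracket X Y).

(* Tensors and connections on SU(2) are written in the left trivialization: a
   tangent vector at a is a * X with X in su(2).  [phi a X] stands for the X'
   with phi (a * X) = a * X'. *)
Definition lorentz_force c (phi : mat2 R -> mat2 R -> mat2 R) : Prop :=
  forall a, SU2 a -> forall X, su2 X ->
    su2 (phi a X) /\
    forall Y, su2 Y -> magnetic_field c X Y = berger c (phi a X) Y.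

(* [nabla a X Y] is the value at a, moved back to su(2), of the covariant
   derivative along X of the left invariant field Y.  As left invariant fields
   form a global frame, these values determine the connection.  The term
   Z (g (X, Y)) in metric compatibility is 0 since g (X, Y) is constant. *)
Record levi_civita c (nabla : mat2 R -> mat2 R -> mat2 R -> mat2 R) : Prop := {
  lc_su2 : forall a X Y, SU2 a -> su2 X -> su2 Y -> su2 (nabla a X Y) ;
  lc_linearl : forall a r X X' Y, SU2 a -> su2 X -> su2 X' -> su2 Y ->
    nabla a (rscale r X + X') Y = rscale r (nabla a X Y) + nabla a X' Y ;
  lc_linearr : forall a r X Y Y', SU2 a -> su2 X -> su2 Y -> su2 Y' ->
    nabla a X (rscale r Y + Y') = rscale r (nabla a X Y) + nabla a X Y' ;
  lc_torsion_free : forall a X Y, SU2 a -> su2 X -> su2 Y ->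
    nabla a X Y - nabla a Y X = bracket X Y ;
  lc_metric : forall a X Y Z, SU2 a -> su2 X -> su2 Y -> su2 Z ->
    berger c (nabla a Z X) Y + berger c X (nabla a Z Y) = 0 }.

End Algebra.

Section Curves.
Variable R : realType.
Implicit Types (gamma V : R -> mat2 R) (c q t : R).

Definition curve_derivable gamma : Prop :=
  forall t i j, derivable (fun s => complex.Re (gamma s i j)) t 1 /\
                derivable (fun s => complex.Im (gamma s i j)) t 1.

Definition velocity gamma : R -> mat2 R := fun t =>
  \matrix_(i, j) (derive1 (fun s => complex.Re (gamma s i j)) t +i*
                  derive1 (fun s => complex.Im (gamma s i j)) t).

Definition left_triv gamma V : R -> mat2 R := fun t => (gamma t)^-1 * V t.

(* For V = gamma * v, where v is a curve in su(2), the Leibniz rule in the left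
   invariant frame gives D V / dt = gamma * (v' + nabla_(gamma^-1 gamma') v). *)
Definition cov_deriv (nabla : mat2 R -> mat2 R -> mat2 R -> mat2 R)
    gamma V : R -> mat2 R := fun t =>
  gamma t * (velocity (left_triv gamma V) t +
             nabla (gamma t) (left_triv gamma (velocity gamma) t)
                   (left_triv gamma V t)).

Definition magnetic_trajectory (nabla : mat2 R -> mat2 R -> mat2 R -> mat2 R)
    (phi : mat2 R -> mat2 R -> mat2 R) q gamma : Prop :=
  [/\ forall t, SU2 (gamma t), curve_derivable gamma,
      curve_derivable (velocity gamma) &
      forall t, cov_deriv nabla gamma (velocity gamma) t =
        rscale q (gamma t * phi (gamma t) (left_triv gamma (velocity gamma) t))].

End Curves.

Section Homogeneous.
Variable R : realType.
Implicit Types (X Y : mat2 R) (c t : R).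

(* The exponential map of a matrix Lie group is the matrix exponential, taken
   here as the entrywise limit of the power series; exp_K is its restriction to
   the Lie algebra of K. *)
Definition exp_partial_sum X (n : nat) : mat2 R :=
  \sum_(0 <= m < n) (m`!%:R : R[i])^-1 *: X ^+ m.

Definition expG X : mat2 R :=
  \matrix_(i, j) (limn (fun n => complex.Re (exp_partial_sum X n i j)) +i*
                  limn (fun n => complex.Im (exp_partial_sum X n i j))).

Definition expK : mat2 R -> mat2 R := expG.

Definition expGK (Y : mat2 R * mat2 R) : mat2 R * mat2 R := (expG Y.1, expK Y.2).

Definition actGK (b : mat2 R * mat2 R) (x : mat2 R) : mat2 R := b.1 * x * b.2^-1.

Definition in_k X : Prop := exists r, X = rscale r (kk R).

Definition in_m X : Prop := exists r s, X = rscale r (ii R) + rscale s (jj R).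

Definition in_p c (Y : mat2 R * mat2 R) : Prop :=
  exists V W, [/\ in_m V, in_k W & Y = (V + W, rscale ((1 - c) / 4) W)].

Definition k_part X : mat2 R := rscale (eta1 X) (kk R).

Definition m_part X : mat2 R := X - k_part X.

Definition hat c X : mat2 R * mat2 R :=
  (m_part X + rscale (4 / (c + 3)) (k_part X),
   rscale (- ((c - 1) / (c + 3))) (k_part X)).

Definition orbit_curve (Y : mat2 R * mat2 R) : R -> mat2 R := fun t =>
  actGK (expGK (rscale t Y.1, rscale t Y.2)) 1.

End Homogeneous.

(* Main.v *)
Require Import Defs.
From HB Require Import structures.
From mathcomp Require Import all_boot all_order all_algebra.
From mathcomp Require Import sesquilinear spectral complex.
From mathcomp Require Import ring lra.
From mathcomp Require Import all_classical all_reals all_analysis.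

(** Write a curve in SU(2) through its body velocity v = gamma^-1
    gamma', a curve in su(2). The Koszul formula gives the diagonal of
    the connection, nabla_v v = - (c - 1) / (c + 3) eta1(v) [v, kk]
    ([levi_civita_diag]), and the definition of the magnetic field gives
    phi v = 1 / 2 [v, kk] ([lorentz_forceE]). Hence gamma is a magnetic
    trajectory exactly when
      v' = (q / 2 + (c - 1) / (c + 3) eta1(v)) [v, kk]
    ([magnetic_trajectoryP]). Since [v, kk] has no component along kk,
    eta1(v) is a constant of the motion ([eta1_conserved]), so the
    coefficient is a constant b and the equation becomes the linear one
    v' = [v, B] with B = b kk.

    Its solution is v(t) = Ad(exp(-t B)) v(0) ([rotating_frame_unique]),
    and the curves from 1 with this body velocity are integrated in
    closed form: gamma(t) = exp(t (v(0) - B)) exp(t B)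
    ([mderiv_two_factors] for existence, [two_factors_unique] for
    uniqueness). Both uniqueness statements hold because multiplying the
    unknown by the inverses of the expected factors gives a curve with
    zero derivative, hence a constant one.

    On the other side, the orbit of 1 under the one-parameter group of
    hat X is exp(t A) exp(t K) with A the first component of hat X and K
    = (c - 1) / (c + 3) X_k ([orbit_curveE]). Both K and xi lie on the
    line spanned by kk, so the remaining factor exp(t q/2 xi) merges
    with exp(t K) into exp(t B'), where B' = K + q/2 xi. The initial
    velocity is X + q/2 xi = A + B', and B' = B is the identity
      (c - 1) / (c + 3) z + q (c + 3) / 8
        = q / 2 + (c - 1) / (c + 3) (z + q (c + 3) / 8)
    with z = eta1(X).

    The exponential is computed by a polar decomposition: an element of
    su(2) is r U with U^2 = -1, and then the power series of exp splits
    into those of cos and sin ([expG_rotation]). *)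

Set Implicit Arguments.
Unset Strict Implicit.
Unset Printing Implicit Defensive.

Import Order.TTheory GRing.Theory Num.Theory.
Local Open Scope ring_scope.

(** * Derivatives of complex and matrix curves *)

Section ComplexDerivative.
Local Open Scope complex_scope.
Context {R : realType}.
Implicit Types f g df dg : R -> R[i].

(** Real and imaginary parts are differentiated separately because
    [velocity] is defined through them. *)
Definition cderiv f df : Prop := forall t : R,
  is_derive t 1 (fun s => complex.Re (f s)) (complex.Re (df t)) /\
  is_derive t 1 (fun s => complex.Im (f s)) (complex.Im (df t)).

Lemma ReD (x y : R[i]) : complex.Re (x + y) = complex.Re x + complex.Re y.
Proof. by case: x; case: y. Qed.

Lemma ImD (x y : R[i]) : complex.Im (x + y) = complex.Im x + complex.Im y.
Proof. by case: x; case: y. Qed.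

Lemma ReM (x y : R[i]) : complex.Re (x * y) =
  complex.Re x * complex.Re y - complex.Im x * complex.Im y.
Proof. by case: x; case: y. Qed.

Lemma ImM (x y : R[i]) : complex.Im (x * y) =
  complex.Re x * complex.Im y + complex.Im x * complex.Re y.
Proof. by case: x; case: y. Qed.

Lemma cderiv_ext f g df dg : f =1 g -> df =1 dg -> cderiv f df -> cderiv g dg.
Proof. by move=> /funext <- /funext <-. Qed.

Lemma cderiv_cst z : cderiv (fun=> z) (fun=> 0).
Proof. by move=> t; split; apply: is_derive_cst. Qed.

Lemma cderivD f g df dg : cderiv f df -> cderiv g dg ->
  cderiv (fun t => f t + g t) (fun t => df t + dg t).
Proof.
move=> hf hg t; have [fR fI] := hf t; have [gR gI] := hg t.
split.
- under eq_fun do rewrite ReD.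
  by rewrite ReD; apply: is_deriveD.
- under eq_fun do rewrite ImD.
  by rewrite ImD; apply: is_deriveD.
Qed.

Lemma cderivM f g df dg : cderiv f df -> cderiv g dg ->
  cderiv (fun t => f t * g t) (fun t => df t * g t + f t * dg t).
Proof.
move=> hf hg t; have [fR fI] := hf t; have [gR gI] := hg t.
split.
- under eq_fun do rewrite ReM.
  have H := is_deriveB (is_deriveM fR gR) (is_deriveM fI gI).
  apply: (is_derive_eq H).
  by rewrite ReD !ReM /GRing.scale /=; ring.
- under eq_fun do rewrite ImM.
  have H := is_deriveD (is_deriveM fR gI) (is_deriveM fI gR).
  apply: (is_derive_eq H).
  by rewrite ImD !ImM /GRing.scale /=; ring.
Qed.

Lemma cderiv_conj f df : cderiv f df ->
  cderiv (fun t => Num.conj (f t)) (fun t => Num.conj (df t)).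
Proof.
move=> hf t; have [fR fI] := hf t; split.
- have -> : (fun s => complex.Re (Num.conj (f s))) =
      (fun s => complex.Re (f s)).
    by apply/funext => s; case: (f s).
  by apply: is_derive_eq fR _; case: (df t).
- have -> : (fun s => complex.Im (Num.conj (f s))) =
      - (fun s => complex.Im (f s)).
    by apply/funext => s; rewrite /GRing.opp /=; case: (f s).
  apply: (is_derive_eq (is_deriveN fI)).
  by case: (df t).
Qed.

Lemma cderiv_sum (I : Type) (s : seq I) (f df : I -> R -> R[i]) :
  (forall i, cderiv (f i) (df i)) ->
  cderiv (fun t => \sum_(i <- s) f i t) (fun t => \sum_(i <- s) df i t).
Proof.
move=> hf; elim: s => [|i s IH].
  by apply: cderiv_ext (cderiv_cst 0) => t; rewrite big_nil.
by apply: cderiv_ext (cderivD (hf i) IH) => t; rewrite big_cons.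
Qed.

Lemma cderiv0_cst f : cderiv f (fun=> 0) -> forall s t, f s = f t.
Proof.
move=> hf s t; apply/eqP; rewrite eq_complex; apply/andP; split; apply/eqP.
  by apply: (is_derive_0_is_cst (f := fun r => complex.Re (f r))) => r;
     have [] := hf r.
by apply: (is_derive_0_is_cst (f := fun r => complex.Im (f r))) => r;
   have [] := hf r.
Qed.

Lemma cderiv_unique f df dg : cderiv f df -> cderiv f dg -> df =1 dg.
Proof.
move=> hf hg t; have [fR fI] := hf t; have [gR gI] := hg t.
have eR := etrans (esym (@derive_val _ _ _ _ _ _ _ fR))
                  (@derive_val _ _ _ _ _ _ _ gR).
have eI := etrans (esym (@derive_val _ _ _ _ _ _ _ fI))
                  (@derive_val _ _ _ _ _ _ _ gI).
by apply/eqP; rewrite eq_complex eR eI !eqxx.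
Qed.

End ComplexDerivative.

Section MatrixDerivative.
Local Open Scope complex_scope.
Local Open Scope sesquilinear_scope.
Context {R : realType}.

Definition mderiv {n : nat} (f df : R -> 'M[R[i]]_n) : Prop :=
  forall i j, cderiv (fun t => f t i j) (fun t => df t i j).

Lemma mderiv_cst n (M : 'M[R[i]]_n) : mderiv (fun=> M) (fun=> 0).
Proof.
by move=> i j; apply: cderiv_ext (cderiv_cst (M i j)) => t //; rewrite mxE.
Qed.

Lemma mderivD n (f g df dg : R -> 'M[R[i]]_n) : mderiv f df -> mderiv g dg ->
  mderiv (fun t => f t + g t) (fun t => df t + dg t).
Proof.
move=> hf hg i j.
by apply: cderiv_ext (cderivD (hf i j) (hg i j)) => t; rewrite mxE.
Qed.

Lemma mderivM n (f g df dg : R -> 'M[R[i]]_n.+1) : mderiv f df -> mderiv g dg ->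
  mderiv (fun t => f t * g t) (fun t => df t * g t + f t * dg t).
Proof.
move=> hf hg i j.
apply: cderiv_ext (cderiv_sum _ (fun k => cderivM (hf i k) (hg k j))) => t.
  by rewrite mxE.
by rewrite !mxE -big_split.
Qed.

Lemma mderiv_adj n (f df : R -> 'M[R[i]]_n) : mderiv f df ->
  mderiv (fun t => (f t)^t*) (fun t => (df t)^t*).
Proof.
by move=> hf i j; apply: cderiv_ext (cderiv_conj (hf j i)) => t; rewrite !mxE.
Qed.

Lemma mderiv_unique n (f df dg : R -> 'M[R[i]]_n) :
  mderiv f df -> mderiv f dg -> df =1 dg.
Proof.
move=> hf hg t; apply/matrixP => i j.
exact: (cderiv_unique (hf i j) (hg i j)).
Qed.

Lemma mderiv0_cst n (f : R -> 'M[R[i]]_n) : mderiv f (fun=> 0) ->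
  forall s t, f s = f t.
Proof.
move=> hf s t; apply/matrixP => i j; apply: (@cderiv0_cst _ (fun r => f r i j)).
by move=> r; have := hf i j r; rewrite mxE.
Qed.

Lemma mderiv_eq n (f df df' : R -> 'M[R[i]]_n) : mderiv f df -> df =1 df' ->
  mderiv f df'.
Proof. by move=> hf /funext <-. Qed.

Lemma mderiv_velocity (f df : R -> mat2 R) : mderiv f df -> velocity f = df.
Proof.
move=> hf; apply/funext => t; apply/matrixP => i j; rewrite mxE !derive1E.
have [hR hI] := hf i j t.
rewrite (@derive_val _ _ _ _ _ _ _ hR) (@derive_val _ _ _ _ _ _ _ hI).
by case: (df t i j).
Qed.

Lemma mderivP (f : R -> mat2 R) : curve_derivable f <-> mderiv f (velocity f).
Proof.
split => [hf i j t|hf t i j]; last first.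
  by have [hR hI] := hf i j t; split; apply: ex_derive.
have [hR hI] := hf t i j; rewrite mxE /= !derive1E.
by split; apply: DeriveDef.
Qed.

Lemma mderiv_rscale (f df : R -> R) (X : mat2 R) :
  (forall t : R, is_derive t 1 f (df t)) ->
  mderiv (fun t => rscale (f t) X) (fun t => rscale (df t) X).
Proof.
move=> hf i j.
have hC : cderiv (fun t => (f t)%:C) (fun t => (df t)%:C).
  by move=> t; split; [exact: hf | exact: is_derive_cst].
by apply: cderiv_ext (cderivM hC (cderiv_cst (X i j))) => t;
   rewrite !mxE // mulr0 addr0.
Qed.

End MatrixDerivative.

(** * Coordinates on su(2) and SU(2) *)

Local Ltac complex_ring :=
  apply/eqP; rewrite eq_complex /=; apply/andP; split; apply/eqP; ring.

Section QuaternionAlgebra.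
Local Open Scope complex_scope.
Local Open Scope sesquilinear_scope.
Context {R : realType}.
Implicit Types (A B X Y : mat2 R) (x y z r s : R).

Lemma mat2P A B :
  [/\ A 0 0 = B 0 0, A 0 1 = B 0 1, A 1 0 = B 1 0 & A 1 1 = B 1 1] -> A = B.
Proof.
move=> [h00 h01 h10 h11]; apply/matrixP => i j.
have ord2 (k : 'I_2) : k = 0 \/ k = 1.
  by case: k => -[|[|//]] hk; [left|right]; apply: val_inj.
by case: (ord2 i) => ->; case: (ord2 j) => ->.
Qed.

Lemma mx22D (a b c d a' b' c' d' : R[i]) :
  mx22 a b c d + mx22 a' b' c' d' = mx22 (a + a') (b + b') (c + c') (d + d').
Proof. by apply: mat2P; split; rewrite !mxE. Qed.

Lemma mx22Z k (a b c d : R[i]) :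
  k *: mx22 a b c d = mx22 (k * a) (k * b) (k * c) (k * d).
Proof. by apply: mat2P; split; rewrite !mxE. Qed.

Lemma mx22N (a b c d : R[i]) : - mx22 a b c d = mx22 (- a) (- b) (- c) (- d).
Proof. by apply: mat2P; split; rewrite !mxE. Qed.

Lemma mx22M (a b c d a' b' c' d' : R[i]) :
  mx22 a b c d * mx22 a' b' c' d' =
  mx22 (a * a' + b * c') (a * b' + b * d') (c * a' + d * c') (c * b' + d * d').
Proof.
by apply: mat2P; split; rewrite !mxE !big_ord_recl big_ord0 /= !mxE /= addr0.
Qed.

Lemma mx22_1 : (1 : mat2 R) = mx22 1 0 0 1.
Proof. by apply: mat2P; split; rewrite !mxE. Qed.

Lemma mx22_adj (a b c d : R[i]) : (mx22 a b c d)^t* =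
  mx22 (Num.conj a) (Num.conj c) (Num.conj b) (Num.conj d).
Proof. by apply: mat2P; split; rewrite !mxE. Qed.

Lemma mx22_tr (a b c d : R[i]) : \tr (mx22 a b c d) = a + d.
Proof. by rewrite /mxtrace !big_ord_recl big_ord0 /= !mxE /= addr0. Qed.

Lemma det_mat2 A : \det A = A 0 0 * A 1 1 - A 0 1 * A 1 0.
Proof.
rewrite (expand_det_row _ 0) !big_ord_recl big_ord0 /cofactor !det_mx11 !mxE /=.
rewrite addr0 expr0 expr1 mul1r mulN1r mulrN.
by congr (_ * A _ _ - A _ _ * A _ _); apply: val_inj.
Qed.

Lemma mx22_det (a b c d : R[i]) : \det (mx22 a b c d) = a * d - b * c.
Proof. by rewrite det_mat2 !mxE. Qed.

Lemma rscaleA r s X : rscale r (rscale s X) = rscale (r * s) X.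
Proof. by rewrite /rscale scalerA rmorphM. Qed.

Lemma rscaleDl r s X : rscale (r + s) X = rscale r X + rscale s X.
Proof. by rewrite /rscale rmorphD scalerDl. Qed.

Definition su2_vec x y z : mat2 R :=
  rscale x (ii R) + rscale y (jj R) + rscale z (kk R).

Lemma su2_vecE x y z :
  su2_vec x y z = mx22 (0 +i* z) ((- y) +i* x) (y +i* x) (0 -i* z).
Proof.
rewrite /su2_vec /rscale !mx22Z !mx22D.
by congr mx22; complex_ring.
Qed.

Lemma su2P X : su2 X <-> exists x y z, X = su2_vec x y z.
Proof.
split => [[hadj htr]|[x [y [z ->]]]]; last first.
  rewrite /su2 su2_vecE mx22_adj mx22N mx22_tr; split.
    by congr mx22; complex_ring.
  complex_ring.
exists (complex.Im (X 1 0)), (complex.Re (X 1 0)), (complex.Im (X 0 0)).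
have h00 := congr1 (fun M : mat2 R => M 0 0) hadj.
have h01 := congr1 (fun M : mat2 R => M 0 1) hadj.
rewrite !mxE in h00 h01.
rewrite su2_vecE; apply: mat2P.
move: htr; rewrite /mxtrace !big_ord_recl big_ord0 /=.
have -> : lift ord0 ord0 = 1 :> 'I_2 by apply: val_inj.
move: h00 h01; rewrite !mxE /=.
case: (X 0 0) => a a'; case: (X 0 1) => b b'.
case: (X 1 0) => e e'; case: (X 1 1) => d d'.
move=> /(congr1 (@complex.Re R)) /= h1.
move=> /eqP; rewrite eq_complex => /andP[/eqP/= h3 /eqP/= h4].
move=> /eqP; rewrite eq_complex => /andP[/eqP/= h5 /eqP/= h6].
by split; apply/eqP; rewrite eq_complex /=; apply/andP; split; apply/eqP; lra.
Qed.

Lemma su2_vecD x y z x' y' z' :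
  su2_vec x y z + su2_vec x' y' z' = su2_vec (x + x') (y + y') (z + z').
Proof.
rewrite !su2_vecE mx22D.
by congr mx22; complex_ring.
Qed.

Lemma su2_vecZ r x y z :
  rscale r (su2_vec x y z) = su2_vec (r * x) (r * y) (r * z).
Proof.
rewrite !su2_vecE /rscale mx22Z.
by congr mx22; complex_ring.
Qed.

Lemma su2_vecN x y z : - su2_vec x y z = su2_vec (- x) (- y) (- z).
Proof.
rewrite !su2_vecE mx22N.
by congr mx22; complex_ring.
Qed.

Lemma su2_vecM x y z x' y' z' : su2_vec x y z * su2_vec x' y' z' =
  rscale (- (x * x' + y * y' + z * z')) 1 +
  su2_vec (y * z' - z * y') (z * x' - x * z') (x * y' - y * x').
Proof.
rewrite !su2_vecE /rscale mx22_1 mx22M mx22Z mx22D.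
by congr mx22; complex_ring.
Qed.

Lemma kk_su2_vec : kk R = su2_vec 0 0 1.
Proof.
by rewrite su2_vecE; congr mx22; apply/eqP; rewrite eq_complex /= ?oppr0 !eqxx.
Qed.

Lemma bracket_su2_vec x y z x' y' z' :
  bracket (su2_vec x y z) (su2_vec x' y' z') =
  su2_vec (2 * (y * z' - z * y')) (2 * (z * x' - x * z'))
          (2 * (x * y' - y * x')).
Proof.
by rewrite /bracket !su2_vecE !mx22M mx22N mx22D; congr mx22; complex_ring.
Qed.

Lemma g1_su2_vec x y z x' y' z' :
  g1 (su2_vec x y z) (su2_vec x' y' z') = x * x' + y * y' + z * z'.
Proof.
by rewrite /g1 !su2_vecE mx22M mx22_tr /=; field.
Qed.

Lemma eta1_su2_vec x y z : eta1 (su2_vec x y z) = z.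
Proof. by rewrite /eta1 kk_su2_vec g1_su2_vec !mul0r !add0r mul1r. Qed.

Lemma SU2_invE A : SU2 A -> A^-1 = A^t*.
Proof. by case=> hA _; rewrite -invmx_unitary. Qed.

Lemma SU2_adjM A : SU2 A -> A^t* * A = 1.
Proof.
case=> hA _; rewrite -(invmx_unitary hA); apply: (mulVr (R := 'M[R[i]]_2)).
exact: (unitarymx_unit hA).
Qed.

Lemma SU2_Madj A : SU2 A -> A * A^t* = 1.
Proof. by case=> /unitarymxP. Qed.

(** For determinant 1 the inverse is the classical adjugate. This turns
    the derivative of the determinant into the trace of gamma^* gamma'. *)
Lemma SU2_adjE A : SU2 A -> A^t* = mx22 (A 1 1) (- A 0 1) (- A 1 0) (A 0 0).
Proof.
move=> sA; have dA : A 0 0 * A 1 1 - A 0 1 * A 1 0 = 1.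
  by rewrite -det_mat2; case: sA.
have hA : A = mx22 (A 0 0) (A 0 1) (A 1 0) (A 1 1).
  by apply: mat2P; split; rewrite !mxE.
have AB : A * mx22 (A 1 1) (- A 0 1) (- A 1 0) (A 0 0) = 1.
  by rewrite {1}hA mx22M mx22_1 -dA; congr mx22; ring.
by rewrite -[LHS]mulr1 -AB mulrA SU2_adjM // mul1r.
Qed.

Lemma SU2_mul A B : SU2 A -> SU2 B -> SU2 (A * B).
Proof.
move=> [hA dA] [hB dB]; split; first exact: (mul_unitarymx hA hB).
by rewrite (det_mulmx A B : \det (A * B) = _) dA dB mulr1.
Qed.

Lemma SU2_unit A : SU2 A -> A \is a GRing.unit.
Proof. by case=> /unitarymx_unit. Qed.

Lemma eta1E X : su2 X -> eta1 X = complex.Im (X 0 0).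
Proof. by move=> /su2P[x [y [z ->]]]; rewrite eta1_su2_vec su2_vecE mxE. Qed.

Lemma eta1_bracket_kk X : su2 X -> eta1 (bracket X (kk R)) = 0.
Proof.
move=> /su2P[x [y [z ->]]].
by rewrite kk_su2_vec bracket_su2_vec eta1_su2_vec; ring.
Qed.

Lemma eta1_rscale r X : su2 X -> eta1 (rscale r X) = r * eta1 X.
Proof. by move=> /su2P[x [y [z ->]]]; rewrite su2_vecZ !eta1_su2_vec. Qed.

Lemma su2N X : su2 X -> su2 (- X).
Proof.
by move=> /su2P[x [y [z ->]]]; rewrite su2_vecN; apply/su2P; do 3 eexists.
Qed.

Lemma su2_bracket X Y : su2 X -> su2 Y -> su2 (bracket X Y).
Proof.
move=> /su2P[x [y [z ->]]] /su2P[x' [y' [z' ->]]].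
by rewrite bracket_su2_vec; apply/su2P; do 3 eexists.
Qed.

Lemma su2_rscale r X : su2 X -> su2 (rscale r X).
Proof.
by move=> /su2P[x [y [z ->]]]; rewrite su2_vecZ; apply/su2P; do 3 eexists.
Qed.

Lemma su2_kk : su2 (kk R).
Proof. by apply/su2P; exists 0, 0, 1; exact: kk_su2_vec. Qed.

Lemma bracketZr r X Y : bracket X (rscale r Y) = rscale r (bracket X Y).
Proof. by rewrite /bracket /rscale -scalerAl -scalerAr scalerBr. Qed.

(** Unit vectors of su(2) are the imaginary units of the quaternions. *)
Lemma su2_vec_sqr (x y z : R) : x * x + y * y + z * z = 1 ->
  su2_vec x y z * su2_vec x y z = -1.
Proof.
move=> h; rewrite su2_vecM h (mulrC y x) (mulrC z x) (mulrC z y) !subrr.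
by rewrite /su2_vec /rscale !scale0r !addr0 rmorphN rmorph1 scaleN1r.
Qed.

(** For X = 0 the radius is 0 and any unit vector serves; otherwise X is
    divided by its norm. *)
Lemma su2_polar X : su2 X -> exists r x y z : R,
  x * x + y * y + z * z = 1 /\ X = rscale r (su2_vec x y z).
Proof.
move=> /su2P[x [y [z ->]]].
have sq0 : 0 <= x * x + y * y + z * z by rewrite !addr_ge0 // -expr2 sqr_ge0.
have [h0|h0] := eqVneq (x * x + y * y + z * z) 0.
  have h : x ^+ 2 + y ^+ 2 + z ^+ 2 == 0 by apply/eqP; rewrite -h0; ring.
  move: h; rewrite !paddr_eq0 ?addr_ge0 ?sqr_ge0 // !sqrf_eq0.
  move=> /andP[/andP[/eqP -> /eqP ->] /eqP ->].
  exists 0, 0, 0, 1; split; first by ring.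
  by rewrite su2_vecZ !mul0r.
set n := Num.sqrt (x * x + y * y + z * z).
have nn : n * n = x * x + y * y + z * z by rewrite -expr2 sqr_sqrtr.
have n0 : n != 0 by apply: contra_neq h0 => n0; rewrite -nn n0 mul0r.
exists n, (n^-1 * x), (n^-1 * y), (n^-1 * z); split; last first.
  by rewrite su2_vecZ !mulVKf.
transitivity (n^-1 * n^-1 * (x * x + y * y + z * z)); first by ring.
by rewrite -nn; field.
Qed.

(** SU(2) is the group of unit quaternions: the norm is both the
    determinant and the diagonal of the product with the adjoint. *)
Lemma SU2_quaternion (r x y z : R) : r * r + x * x + y * y + z * z = 1 ->
  SU2 (rscale r 1 + su2_vec x y z).
Proof.
move=> h.
have -> : rscale r 1 + su2_vec x y z =
    mx22 (r +i* z) ((- y) +i* x) (y +i* x) (r -i* z).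
  by rewrite su2_vecE /rscale mx22_1 mx22Z mx22D; congr mx22; complex_ring.
have E1 : (r +i* z) * (r -i* z) - ((- y) +i* x) * (y +i* x) = 1.
  rewrite -[RHS]/(1%:C) -h.
  complex_ring.
split; last by rewrite mx22_det E1.
apply/unitarymxP; change (mx22 (r +i* z) ((- y) +i* x) (y +i* x) (r -i* z) *
  (mx22 (r +i* z) ((- y) +i* x) (y +i* x) (r -i* z))^t* = 1).
rewrite mx22_adj mx22M mx22_1 -[1]E1.
by congr mx22; complex_ring.
Qed.

End QuaternionAlgebra.

(** * The exponential map on su(2) *)

Section Exponential.
Local Open Scope complex_scope.
Local Open Scope sesquilinear_scope.
Context {R : realType}.
Implicit Types (A B X U : mat2 R) (r s t : R).

(** As U^2 = -1, even powers are multiples of 1 and odd powers are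
    multiples of U; [cos_coeff] vanishes in odd degree and [sin_coeff]
    in even degree, so each parity leaves one of the two summands. *)
Lemma exp_term_rotation r U m : U * U = -1 ->
  (m`!%:R : R[i])^-1 *: (rscale r U) ^+ m =
  rscale (cos_coeff r m) 1 + rscale (sin_coeff r m) U.
Proof.
move=> hU.
have even_pow k : U ^+ k.*2 = rscale ((-1) ^+ k) 1.
  rewrite -mul2n exprM expr2 hU /rscale rmorphXn rmorphN rmorph1.
  by rewrite -signr_odd -[in RHS]signr_odd; case: (odd k);
     rewrite ?expr1 ?expr0 ?scaleN1r ?scale1r.
have fact_real : (m`!%:R : R[i])^-1 = (m`!%:R^-1)%:C.
  by rewrite fmorphV rmorph_nat.
rewrite fact_real /rscale exprZn scalerA -rmorphXn -rmorphM /=.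
have := odd_double_half m; case: (boolP (odd m)) => hm /= Em.
- have -> : U ^+ m = rscale ((-1) ^+ m./2) U.
    by rewrite -[m in LHS]Em exprS even_pow /rscale -scalerAr mulr1.
  have -> : cos_coeff r m = 0 by rewrite /cos_coeff /= hm !mul0r.
  rewrite scale0r add0r scalerA -rmorphM /=; congr (_ %:C *: U).
  have -> : sin_coeff r m = 1 * (-1) ^+ m./2 * r ^+ m / m`!%:R.
    by rewrite /sin_coeff /= hm -[in m.-1]Em /= doubleK.
  by rewrite mul1r [RHS]mulrC (mulrC (_ ^+ _)) mulrA.
- have -> : U ^+ m = rscale ((-1) ^+ m./2) 1 by rewrite -[m in LHS]Em even_pow.
  have -> : sin_coeff r m = 0 by rewrite /sin_coeff /= (negbTE hm) !mul0r.
  rewrite scale0r addr0 scalerA -rmorphM /=; congr (_ %:C *: 1).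
  by rewrite /cos_coeff /= hm mul1r [RHS]mulrC (mulrC (_ ^+ _)) mulrA.
Qed.

Lemma exp_partial_sum_rotation r U n : U * U = -1 ->
  exp_partial_sum (rscale r U) n =
  rscale (series (cos_coeff r) n) 1 + rscale (series (sin_coeff r) n) U.
Proof.
move=> hU; rewrite /exp_partial_sum /series /rscale !rmorph_sum /=.
rewrite !scaler_suml -big_split.
by apply: eq_bigr => m _; rewrite exp_term_rotation.
Qed.

Lemma expG_rotation r U : U * U = -1 ->
  expG (rscale r U) = rscale (cos r) 1 + rscale (sin r) U.
Proof.
move=> hU; apply/matrixP => i j.
have lim_comb (a b : R) :
    limn (fun n => series (cos_coeff r) n * a + series (sin_coeff r) n * b) =
    cos r * a + sin r * b.
  apply: cvg_lim => //; rewrite cos.unlock sin.unlock.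
  apply: cvgD; apply: cvgMl.
    exact: is_cvg_series_cos_coeff.
  exact: is_cvg_series_sin_coeff.
rewrite !mxE; apply/eqP; rewrite eq_complex; apply/andP; split; apply/eqP => /=.
- have -> : (fun n => complex.Re (exp_partial_sum (rscale r U) n i j)) =
     (fun n => series (cos_coeff r) n * (i == j)%:R +
               series (sin_coeff r) n * complex.Re (U i j)).
    apply/funext => n; rewrite exp_partial_sum_rotation // !mxE.
    by case: (U i j) => a b; case: (i == j) => /=; rewrite !mul0r !subr0.
  rewrite lim_comb.
  by case: (U i j) => a b; case: (i == j) => /=; rewrite !mul0r !subr0.
- have -> : (fun n => complex.Im (exp_partial_sum (rscale r U) n i j)) =
     (fun n => series (cos_coeff r) n * 0 +
               series (sin_coeff r) n * complex.Im (U i j)).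
    apply/funext => n; rewrite exp_partial_sum_rotation // !mxE.
    by case: (U i j) => a b; case: (i == j) => /=; rewrite !mul0r !addr0.
  rewrite lim_comb.
  by case: (U i j) => a b; case: (i == j) => /=; rewrite !mul0r !addr0.
Qed.

(** One polar decomposition serves the whole line through X, so that the
    facts on one-parameter subgroups below reduce to trigonometric
    identities. *)
Lemma expG_line X : su2 X -> exists r x y z : R,
  [/\ x * x + y * y + z * z = 1, X = rscale r (su2_vec x y z) &
      forall t, expG (rscale t X) =
        rscale (cos (t * r)) 1 + rscale (sin (t * r)) (su2_vec x y z)].
Proof.
move=> /su2_polar[r [x [y [z [h ->]]]]]; exists r, x, y, z; split=> // s.
by rewrite rscaleA expG_rotation // su2_vec_sqr.
Qed.

Lemma expG_lineD X s t : su2 X ->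
  expG (rscale (s + t) X) = expG (rscale s X) * expG (rscale t X).
Proof.
move=> /expG_line[r [x [y [z [h _ E]]]]].
rewrite !E mulrDl cosD sinD /rscale !mulrDl !mulrDr.
rewrite -!scalerAl -!scalerAr !mul1r !mulr1.
rewrite (su2_vec_sqr h) !scalerA -!rmorphM /= !scalerN.
rewrite rmorphB rmorphD /= scalerBl scalerDl.
have swap (a b c d : mat2 R) : a - b + (c + d) = a + d + (c - b).
  by rewrite addrACA [RHS]addrACA (addrC d) addrACA.
exact: swap.
Qed.

Lemma expG_line0 X : su2 X -> expG (rscale 0 X) = 1.
Proof.
move=> /expG_line[r [x [y [z [_ _ ->]]]]].
by rewrite mul0r cos0 sin0 /rscale scale0r addr0 scale1r.
Qed.

Lemma expG_line_SU2 X t : su2 X -> SU2 (expG (rscale t X)).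
Proof.
move=> /expG_line[r [x [y [z [h _ ->]]]]]; rewrite su2_vecZ.
apply: SU2_quaternion.
by rewrite -[RHS](cos2Dsin2 (t * r)) -[X in _ = _ + X]mulr1 -h; ring.
Qed.

Lemma expG_line_comm X t : su2 X ->
  X * expG (rscale t X) = expG (rscale t X) * X.
Proof.
move=> /expG_line[r [x [y [z [_ -> ->]]]]]; rewrite /rscale.
rewrite mulrDl mulrDr -!scalerAl -!scalerAr mul1r mulr1 !scalerA.
by rewrite ![r%:C * _]mulrC.
Qed.

Lemma expG_lineNl X t : su2 X -> expG (rscale (- t) X) * expG (rscale t X) = 1.
Proof. by move=> sX; rewrite -expG_lineD // addNr expG_line0. Qed.

Lemma expG_lineNr X t : su2 X -> expG (rscale t X) * expG (rscale (- t) X) = 1.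
Proof. by move=> sX; rewrite -expG_lineD // subrr expG_line0. Qed.

Lemma mderiv_expG_line X : su2 X ->
  mderiv (fun t => expG (rscale t X)) (fun t => expG (rscale t X) * X).
Proof.
move=> /expG_line[r [x [y [z [h -> E]]]]].
set U := su2_vec x y z in E *.
have dlin (t : R) : is_derive t 1 (fun s => s * r) r.
  have H := is_deriveM (is_derive_id t 1) (is_derive_cst r t 1).
  by apply: (is_derive_eq H); rewrite /GRing.scale /= mulr0 add0r mulr1.
rewrite (funext E).
have hcos := mderiv_rscale 1
  (fun t => is_derive1_comp (is_derive_cos _) (dlin t)).
have hsin := mderiv_rscale U
  (fun t => is_derive1_comp (is_derive_sin _) (dlin t)).
apply: (mderiv_eq (mderivD hcos hsin)).
move=> t /=; rewrite E /rscale mulrDl -!scalerAl -!scalerAr mul1r (su2_vec_sqr h).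
by rewrite !scalerA -!rmorphM /= scalerN -scaleNr -rmorphN addrC mulNr.
Qed.

End Exponential.

(** * Connection and Lorentz force of the Berger metric *)

Section BergerSphere.
Context {R : realType}.
Implicit Types (X Y W : mat2 R) (c : R).

Lemma berger_su2_vec c (x y z x' y' z' : R) :
  berger c (su2_vec x y z) (su2_vec x' y' z') =
  4 / (c + 3) * (x * x' + y * y' + z * z' - (c - 1) / (c + 3) * (z * z')).
Proof. by rewrite /berger g1_su2_vec !eta1_su2_vec. Qed.

Lemma berger_sym c X Y : su2 X -> su2 Y -> berger c X Y = berger c Y X.
Proof.
move=> /su2P[x [y [z ->]]] /su2P[x' [y' [z' ->]]].
by rewrite !berger_su2_vec; ring.
Qed.

Lemma berger_addr c X Y W : su2 X -> su2 Y -> su2 W ->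
  berger c X (Y + W) = berger c X Y + berger c X W.
Proof.
move=> /su2P[x [y [z ->]]] /su2P[x' [y' [z' ->]]] /su2P[a [b [d ->]]].
by rewrite su2_vecD !berger_su2_vec; ring.
Qed.

(** The metric is diagonal in the basis ii, jj, kk, with coefficients 4
    / (c + 3) (twice) and (4 / (c + 3))^2, nonzero when c > -3. *)
Lemma berger_inj c X W : - 3 < c -> su2 X -> su2 W ->
  (forall Y, su2 Y -> berger c X Y = berger c W Y) -> X = W.
Proof.
move=> hc /su2P[x [y [z ->]]] /su2P[x' [y' [z' ->]]] h.
have c3 : c + 3 != 0 by rewrite gt_eqF //; lra.
have hY (a b d : R) : su2 (su2_vec a b d) by apply/su2P; exists a, b, d.
have k0 : 4 / (c + 3) != 0 :> R by rewrite mulf_neq0 ?invr_eq0 ?pnatr_eq0.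
have key a b d : x * a + y * b + z * d - (c - 1) / (c + 3) * (z * d) =
    x' * a + y' * b + z' * d - (c - 1) / (c + 3) * (z' * d).
  by apply: (mulfI k0); rewrite -!berger_su2_vec; exact/h/hY.
have ex : x = x' by move: (key 1 0 0); lra.
have ey : y = y' by move: (key 0 1 0); lra.
have ez : z = z'.
  (* The third coefficient 1 - (c - 1) / (c + 3) equals 4 / (c + 3). *)
  apply: (mulfI k0); transitivity (z - (c - 1) / (c + 3) * z); first by field.
  transitivity (z' - (c - 1) / (c + 3) * z'); last by field.
  by move: (key 0 0 1); rewrite !(mulr0, add0r, mulr1).
by rewrite ex ey ez.
Qed.

(** Koszul: metric compatibility and absence of torsion give g(nabla_X
    X, Y) = - g(X, [X, Y]). The bi-invariant part of g contributes
    nothing on the right, which leaves the eta1 term. *)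
Lemma levi_civita_diag c nabla a X : - 3 < c -> levi_civita c nabla ->
  SU2 a -> su2 X ->
  nabla a X X = rscale (- ((c - 1) / (c + 3)) * eta1 X) (bracket X (kk R)).
Proof.
move=> hc hn sa sX.
have sk := su2_kk; have snn := lc_su2 hn sa.
apply: (berger_inj hc); [exact: snn|exact/su2_rscale/su2_bracket|move=> Y sY].
have koszul : berger c (nabla a X X) Y = - berger c X (bracket X Y).
  have met := lc_metric hn sa sX sY sX.
  have metY := lc_metric hn sa sX sX sY.
  have tor := lc_torsion_free hn sa sX sY.
  have sp : nabla a X Y = bracket X Y + nabla a Y X by rewrite -tor subrK.
  rewrite sp berger_addr // in met; [|exact: su2_bracket|exact: snn].
  rewrite (berger_sym _ (snn _ _ sY sX) sX) in metY.
  move: met metY; lra.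
rewrite koszul {koszul sk snn}.
move: sX sY => /su2P[x [y [z ->]]] /su2P[x' [y' [z' ->]]].
rewrite eta1_su2_vec kk_su2_vec !bracket_su2_vec su2_vecZ !berger_su2_vec.
by field; rewrite gt_eqF //; lra.
Qed.

Lemma lorentz_forceE c phi a X : - 3 < c -> lorentz_force c phi ->
  SU2 a -> su2 X -> phi a X = rscale (1 / 2) (bracket X (kk R)).
Proof.
move=> hc hp sa sX; have [sp hY] := hp _ sa _ sX.
apply: (berger_inj hc) => //; first exact/su2_rscale/su2_bracket/su2_kk.
move=> Y sY; rewrite -hY // /magnetic_field /contact_form.
move: sX sY => /su2P[x [y [z ->]]] /su2P[x' [y' [z' ->]]].
rewrite kk_su2_vec !bracket_su2_vec su2_vecZ !berger_su2_vec eta1_su2_vec.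
by field; rewrite gt_eqF //; lra.
Qed.

End BergerSphere.

(** * Curves with a prescribed body velocity *)

Section LeftTrivialization.
Local Open Scope complex_scope.
Local Open Scope sesquilinear_scope.
Context {R : realType}.
Implicit Types (A B X : mat2 R) (gamma v dv : R -> mat2 R) (t : R).

(** Differentiating gamma^* gamma = 1 gives the skew-hermitian
    condition, and differentiating det gamma = 1 gives the trace
    condition. *)
Lemma su2_body_velocity gamma v : (forall t, SU2 (gamma t)) ->
  mderiv gamma (fun t => gamma t * v t) -> forall t, su2 (v t).
Proof.
move=> sg hg t.
have vE : v t = (gamma t)^t* * (gamma t * v t) by rewrite mulrA SU2_adjM // mul1r.
split.
- have h1 := mderivM (mderiv_adj hg) hg.
  have h2 : mderiv (fun t => (gamma t)^t* * gamma t) (fun=> 0).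
    by rewrite (funext (fun t => SU2_adjM (sg t))); exact: mderiv_cst.
  have /(_ t) := mderiv_unique h1 h2.
  rewrite -vE => /eqP; rewrite addr_eq0 => /eqP <-.
  by rewrite trmx_mul map_mxM -mulmxE -mulmxA mulmxE SU2_adjM // mulr1.
- have det_deriv : cderiv (fun t => \det (gamma t)) (fun t =>
      (gamma t * v t) 0 0 * gamma t 1 1 + gamma t 0 0 * (gamma t * v t) 1 1 -
      ((gamma t * v t) 0 1 * gamma t 1 0 + gamma t 0 1 * (gamma t * v t) 1 0)).
    have h := cderivD (cderivM (hg 0 0) (hg 1 1))
      (cderivM (cderiv_cst (-1)) (cderivM (hg 0 1) (hg 1 0))).
    apply: cderiv_ext h => r; first by rewrite det_mat2 mulN1r.
    by rewrite mul0r add0r mulN1r.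
  have det_cst : cderiv (fun t => \det (gamma t)) (fun=> 0).
    by apply: cderiv_ext (cderiv_cst 1) => // r; case: (sg r).
  have tr_mx22M (M : mat2 R) (a b d e : R[i]) : \tr (mx22 a b d e * M) =
      a * M 0 0 + b * M 1 0 + d * M 0 1 + e * M 1 1.
    have hM : M = mx22 (M 0 0) (M 0 1) (M 1 0) (M 1 1).
      by apply: mat2P; split; rewrite !mxE.
    by rewrite {1}hM mx22M mx22_tr; ring.
  by rewrite vE SU2_adjE // tr_mx22M -(cderiv_unique det_deriv det_cst t); ring.
Qed.

Lemma expG_lineN X t : expG (rscale (- t) X) = expG (rscale t (- X)).
Proof. by rewrite /rscale rmorphN scaleNr scalerN. Qed.

Lemma mderiv_expG_lineN X : su2 X ->
  mderiv (fun t => expG (rscale (- t) X))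
         (fun t => - (X * expG (rscale (- t) X))).
Proof.
move=> sX; have h := mderiv_expG_line (su2N sX).
have E : (fun t => expG (rscale (- t) X)) = (fun t => expG (rscale t (- X))).
  by apply/funext => t; exact: expG_lineN.
rewrite E; apply: mderiv_eq h _ => t.
by rewrite -(expG_line_comm t (su2N sX)) expG_lineN mulNr.
Qed.

(** This is Ad(exp(-t B)) X. *)
Definition rotating_frame X B t : mat2 R :=
  expG (rscale (- t) B) * X * expG (rscale t B).

Lemma rotating_frame0 X B : su2 B -> rotating_frame X B 0 = X.
Proof.
by move=> sB; rewrite /rotating_frame oppr0 !expG_line0 // mul1r mulr1.
Qed.

Lemma mderiv_rotating_frame X B : su2 B ->
  mderiv (rotating_frame X B) (fun t => bracket (rotating_frame X B t) B).
Proof.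
move=> sB.
have h := mderivM (mderivM (mderiv_expG_lineN sB) (mderiv_cst X))
  (mderiv_expG_line sB).
apply: mderiv_eq h _ => t.
rewrite /bracket /rotating_frame.
move: (expG (rscale t B)) (expG (rscale (- t) B)) => E E'.
by rewrite mulr0 addr0 mulNr mulNr addrC !mulrA.
Qed.

(** The curve Ad(exp(t B)) v(t) has zero derivative. *)
Lemma rotating_frame_unique v B : su2 B ->
  mderiv v (fun t => bracket (v t) B) -> v =1 rotating_frame (v 0) B.
Proof.
move=> sB hv t.
have h := mderivM (mderivM (mderiv_expG_line sB) hv) (mderiv_expG_lineN sB).
have h0 : mderiv (fun t => expG (rscale t B) * v t * expG (rscale (- t) B))
    (fun=> 0).
  apply: mderiv_eq h _ => s; rewrite /bracket.
  move: (expG (rscale s B)) (expG (rscale (- s) B)) => E E'.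
  by rewrite mulrN !mulrBr !mulrA [X in X * E']addrC subrK subrr.
have {h h0} := mderiv0_cst h0 t 0.
rewrite oppr0 (expG_line0 sB) mul1r mulr1 /rotating_frame => <-.
have := expG_lineNl t sB.
move: (expG (rscale t B)) (expG (rscale (- t) B)) => E E' E'E.
by rewrite !mulrA E'E mul1r -mulrA E'E mulr1.
Qed.

Lemma mderiv_two_factors A B : su2 A -> su2 B ->
  mderiv (fun t => expG (rscale t A) * expG (rscale t B))
         (fun t => expG (rscale t A) * expG (rscale t B) *
                   rotating_frame (A + B) B t).
Proof.
move=> sA sB; have h := mderivM (mderiv_expG_line sA) (mderiv_expG_line sB).
apply: mderiv_eq h _ => t.
rewrite /rotating_frame; have := expG_line_comm t sB; have := expG_lineNr t sB.
move: (expG (rscale t A)) (expG (rscale t B)) (expG (rscale (- t) B)).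
move=> E F F' FF' BF.
by rewrite !mulrA -(mulrA E F F') FF' mulr1 mulrDr mulrDl -!mulrA BF.
Qed.

(** The curve gamma(t) exp(-t B) exp(-t A) has zero derivative. *)
Lemma two_factors_unique A B gamma : su2 A -> su2 B -> gamma 0 = 1 ->
  mderiv gamma (fun t => gamma t * rotating_frame (A + B) B t) ->
  forall t, gamma t = expG (rscale t A) * expG (rscale t B).
Proof.
move=> sA sB g0 hg t.
have h := mderivM (mderivM hg (mderiv_expG_lineN sB)) (mderiv_expG_lineN sA).
have h0 : mderiv
    (fun t => gamma t * expG (rscale (- t) B) * expG (rscale (- t) A))
    (fun=> 0).
  apply: mderiv_eq h _ => s; rewrite /rotating_frame.
  have := expG_line_comm (- s) sB; have := expG_lineNr s sB.
  move: (expG (rscale s B)) (expG (rscale (- s) B)) (expG (rscale (- s) A)).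
  move=> F F' E' FF' BF'.
  rewrite BF' !mulrN !mulrA -(mulrA _ F F') FF' mulr1 mulrDr.
  by rewrite addrK subrr.
have {h h0} := mderiv0_cst h0 t 0.
rewrite oppr0 (expG_line0 sB) (expG_line0 sA) g0 !mulr1.
have := expG_lineNl t sB; have := expG_lineNl t sA.
move: (expG (rscale t A)) (expG (rscale (- t) A)) => E E'.
move: (expG (rscale t B)) (expG (rscale (- t) B)) => F F' E'E F'F gF.
by rewrite -[E]mul1r -gF -(mulrA _ E' E) E'E mulr1 -mulrA F'F mulr1.
Qed.

End LeftTrivialization.

(** * The magnetic equation for the body velocity *)

Section MagneticEquation.
Local Open Scope sesquilinear_scope.
Context {R : realType}.
Implicit Types (c q b t : R) (gamma v dv : R -> mat2 R).

(** The derivative of v is a multiple of [v, kk], which is orthogonal to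
    kk. *)
Lemma eta1_conserved v (s : R -> R) : (forall t, su2 (v t)) ->
  mderiv v (fun t => rscale (s t) (bracket (v t) (kk R))) ->
  forall t, eta1 (v t) = eta1 (v 0).
Proof.
move=> sv hv t; rewrite !eta1E //.
apply: (is_derive_0_is_cst (f := fun r => complex.Im (v r 0 0))) => r.
have [_ hI] := hv 0 0 r; apply: is_derive_eq hI _.
have sb := su2_bracket (sv r) su2_kk.
by rewrite -eta1E ?eta1_rscale // ?eta1_bracket_kk ?mulr0 //; exact: su2_rscale.
Qed.

Lemma magnetic_trajectoryP c q nabla phi gamma v dv :
  - 3 < c -> levi_civita c nabla -> lorentz_force c phi ->
  (forall t, SU2 (gamma t)) -> mderiv gamma (fun t => gamma t * v t) ->
  mderiv v dv ->
  magnetic_trajectory nabla phi q gamma <->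
  forall t, dv t =
    rscale (q / 2 + (c - 1) / (c + 3) * eta1 (v t)) (bracket (v t) (kk R)).
Proof.
move=> hc hn hp sg hg hv.
have sv := su2_body_velocity sg hg.
have vg := mderiv_velocity hg.
have lt : left_triv gamma (velocity gamma) = v.
  apply/funext => t.
  by rewrite /left_triv vg SU2_invE // mulrA SU2_adjM // mul1r.
have eqn t : cov_deriv nabla gamma (velocity gamma) t =
    rscale q (gamma t * phi (gamma t) (left_triv gamma (velocity gamma) t)) <->
    dv t =
      rscale (q / 2 + (c - 1) / (c + 3) * eta1 (v t)) (bracket (v t) (kk R)).
  rewrite /cov_deriv lt (mderiv_velocity hv).
  rewrite (levi_civita_diag hc hn (sg t) (sv t)).
  rewrite (lorentz_forceE hc hp (sg t) (sv t)).
  move: (bracket _ _) => W.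
  have -> : rscale q (gamma t * rscale (1 / 2) W) = gamma t * rscale (q / 2) W.
    by rewrite /rscale -scalerAr scalerA -rmorphM mulrA mulr1 -scalerAr.
  rewrite mulNr /rscale rmorphN scaleNr rmorphD scalerDl.
  split => [/(mulrI (SU2_unit (sg t))) <-|->]; first by rewrite subrK.
  by rewrite addrK.
split => [[_ _ _ h] t|h]; first exact/eqn/h.
split => //; first by apply/mderivP; rewrite vg.
- apply/mderivP; rewrite vg (mderiv_velocity (mderivM hg hv)).
  exact: mderivM.
- by move=> t; apply/eqn.
Qed.

(** The body velocity is gamma^* gamma', differentiable since gamma' is. *)
Lemma magnetic_trajectory_body nabla phi q gamma :
  magnetic_trajectory nabla phi q gamma ->
  exists v dv, mderiv gamma (fun t => gamma t * v t) /\ mderiv v dv.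
Proof.
move=> [sg /mderivP hg /mderivP hdg _].
have hv := mderivM (mderiv_adj hg) hdg.
exists (fun t => (gamma t)^t* * velocity gamma t); eexists.
split; last exact: hv.
by apply: mderiv_eq hg _ => t; rewrite mulrA SU2_Madj // mul1r.
Qed.

End MagneticEquation.

(** * The homogeneous orbit and the trajectory *)

Section Orbit.
Context {R : realType}.
Implicit Types (c q r t : R).

Lemma expG_kkD r s t :
  expG (rscale t (rscale r (kk R))) * expG (rscale t (rscale s (kk R))) =
  expG (rscale t (rscale (r + s) (kk R))).
Proof. by rewrite !rscaleA mulrDr expG_lineD //; exact: su2_kk. Qed.

(** The second component of the hat acts through its inverse, which
    reverses the sign of its exponent. *)
Lemma orbit_curveE c (x y z : R) t :
  orbit_curve (hat c (su2_vec x y z)) t =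
  expG (rscale t (su2_vec x y (4 / (c + 3) * z))) *
  expG (rscale t (rscale ((c - 1) / (c + 3) * z) (kk R))).
Proof.
have hat1 : (hat c (su2_vec x y z)).1 = su2_vec x y (4 / (c + 3) * z).
  rewrite /= /m_part /k_part eta1_su2_vec kk_su2_vec.
  rewrite !su2_vecZ su2_vecN !su2_vecD.
  by rewrite !mulr0 oppr0 !addr0 mulr1 subrr add0r.
have sk := su2_rscale ((c - 1) / (c + 3) * z) (su2_kk (R := R)).
have hat2 : rscale t (hat c (su2_vec x y z)).2 =
    rscale (- t) (rscale ((c - 1) / (c + 3) * z) (kk R)).
  by rewrite /= /k_part eta1_su2_vec !rscaleA !mulrN !mulNr !mulrA.
have -> Y : orbit_curve Y t = expG (rscale t Y.1) * (expG (rscale t Y.2))^-1.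
  by rewrite /orbit_curve /actGK (mulr1 (expG (rscale t Y.1))).
rewrite hat1 hat2; congr (_ * _).
have uN := SU2_unit (expG_line_SU2 (- t) sk).
by apply: (mulIr uN); rewrite (expG_lineNr t sk) (mulVr uN).
Qed.

End Orbit.

Theorem theorem5p1 (R : realType) (c q : R) (hc : - 3 < c) (hc1 : c != 1)
    (nabla : mat2 R -> mat2 R -> mat2 R -> mat2 R) (hnabla : levi_civita c nabla)
    (phi : mat2 R -> mat2 R -> mat2 R) (hphi : lorentz_force c phi)
    (Xhat : mat2 R * mat2 R) (hXhat : in_p c Xhat)
    (X : mat2 R) (hX : su2 X) (hcorr : Xhat = hat c X) :
  velocity (orbit_curve Xhat) 0 = X /\
  forall gamma : R -> mat2 R,
    [/\ magnetic_trajectory nabla phi q gamma, gamma 0 = 1 &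
        velocity gamma 0 = X + rscale (q / 2) (xi c)] <->
    (forall t : R,
       gamma t = orbit_curve Xhat t * expK (rscale t (rscale (q / 2) (xi c)))).
Proof.
case/su2P: hX => x [y [z EX]].
have c3 : c + 3 != 0 by rewrite gt_eqF //; lra.
pose k := (c - 1) / (c + 3); pose b := k * z + q / 2 * ((c + 3) / 4).
pose A := su2_vec x y (4 / (c + 3) * z).
have sA : su2 A by apply/su2P; exists x, y, (4 / (c + 3) * z).
have sk r : su2 (rscale r (kk R)) by apply/su2_rscale/su2_kk.
have orbE t : orbit_curve Xhat t =
    expG (rscale t A) * expG (rscale t (rscale (k * z) (kk R))).
  by rewrite hcorr EX orbit_curveE.
have XE : A + rscale (k * z) (kk R) = X.
  rewrite EX kk_su2_vec su2_vecZ su2_vecD !mulr0 !addr0 mulr1.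
  by rewrite (_ : _ + _ = z) // /k; field.
have xiE : rscale (q / 2) (xi c) = rscale (q / 2 * ((c + 3) / 4)) (kk R).
  exact: rscaleA.
have v0E : A + rscale b (kk R) = X + rscale (q / 2) (xi c).
  by rewrite -XE xiE [rscale b _]rscaleDl; exact: addrA.
have curveE t : orbit_curve Xhat t * expK (rscale t (rscale (q / 2) (xi c))) =
    expG (rscale t A) * expG (rscale t (rscale b (kk R))).
  rewrite orbE xiE -(expG_kkD (k * z) (q / 2 * ((c + 3) / 4)) t).
  exact/esym/mulrA.
(* The rate b at which the trajectory's body velocity rotates is the coefficient
   that the magnetic equation assigns to the initial velocity. *)
have etab : q / 2 + k * eta1 (A + rscale b (kk R)) = b.
  rewrite kk_su2_vec su2_vecZ su2_vecD eta1_su2_vec mulr1 /b /k.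
  by field.
split.
  have hO := mderiv_two_factors sA (sk (k * z)).
  rewrite (funext orbE) (mderiv_velocity hO) (rotating_frame0 _ (sk _)).
  by rewrite (expG_line0 sA) (expG_line0 (sk _)) (mulr1 1) mul1r.
move=> gamma; rewrite -v0E; split => [[hm g0 dg0] t|hg].
- have [v [dv [hg hv]]] := magnetic_trajectory_body hm.
  have [sg _ _ _] := hm.
  have sv := su2_body_velocity sg hg.
  have v0 : v 0 = A + rscale b (kk R).
    by rewrite -dg0 (mderiv_velocity hg) g0 mul1r.
  have eqn := (magnetic_trajectoryP q hc hnabla hphi sg hg hv).1 hm.
  have eta_v := eta1_conserved sv (mderiv_eq hv eqn).
  have hv' : mderiv v (fun t => bracket (v t) (rscale b (kk R))).
    by apply: mderiv_eq hv _ => s; rewrite eqn eta_v v0 etab bracketZr.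
  have vE := rotating_frame_unique (sk b) hv'.
  have hgv : mderiv gamma
      (fun t => gamma t *
                rotating_frame (A + rscale b (kk R)) (rscale b (kk R)) t).
    by apply: mderiv_eq hg _ => s; rewrite vE v0.
  by rewrite curveE (two_factors_unique sA (sk b) g0 hgv).
- have {hg} -> : gamma =
      (fun t => expG (rscale t A) * expG (rscale t (rscale b (kk R)))).
    by apply/funext => t; rewrite hg curveE.
  have hg := mderiv_two_factors sA (sk b).
  have hv := mderiv_rotating_frame (A + rscale b (kk R)) (sk b).
  have sg t : SU2 (expG (rscale t A) * expG (rscale t (rscale b (kk R)))).
    by apply: SU2_mul; apply: expG_line_SU2.
  have sv := su2_body_velocity sg hg.
  split.
  + apply/(magnetic_trajectoryP q hc hnabla hphi sg hg hv) => t.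
    have hv' := mderiv_eq hv (fun s => bracketZr b _ (kk R)).
    by rewrite bracketZr (eta1_conserved sv hv') (rotating_frame0 _ (sk b)) etab.
  + by rewrite (expG_line0 sA) (expG_line0 (sk b)) (mulr1 1).
  + rewrite (mderiv_velocity hg) (rotating_frame0 _ (sk b)).
    rewrite (expG_line0 sA) (expG_line0 (sk b)) (mulr1 1).
    exact: mul1r.
Qed.
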